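(* For any natural number $n\ge 4$, there exists an explicitly computable constant $c_n\in(0,1)$ such that for any $c\in(0,c_n)$ we have $$\dim_H FS_n(c)\ \ge\ n-2 .$$
   Context: For $\boldsymbol{\xi}\in\mathbb{R}^n$ (a linear form in $n$ variables, regarded as a $1\times n$ matrix) and $t\ge 1$ let $$\psi_{\boldsymbol{\xi}}(t)=\min\{|\xi_1b_1+\cdots+\xi_nb_n+b_{n+1}| : b_1,\dots,b_{n+1}\in\mathbb{Z},\ 1\le \max_{1\le i\le n}|b_i|\le t\},$$ $\Theta(\boldsymbol{\xi})=\limsup_{t\to\infty}t^{n}\psi_{\boldsymbol{\xi}}(t)$ and $\widetilde\Theta(\boldsymbol{\xi})=\liminf_{t\to\infty}t^{n}\psi_{\boldsymbol{\xi}}(t)$. Put $DI_n(c)=\{\boldsymbol{\xi}\in\mathbb{R}^n:\Theta(\boldsymbol{\xi})=c\}$, $Bad_{1,n}=\{\boldsymbol{\xi}\in\mathbb{R}^n:\widetilde\Theta(\boldsymbol{\xi})>0\}$, $Sing_{1,n}=\{\boldsymbol{\xi}\in\mathbb{R}^n:\Theta(\boldsymbol{\xi})=0\}$, and $$FS_n(c)=DI_n(c)\setminus(Bad_{1,n}\cup Sing_{1,n}).$$ $\dim_H$ denotes Hausdorff dimension. *)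

(* Defs.v *)
From HB Require Import structures.
From mathcomp Require Import all_boot all_order all_algebra.
From mathcomp Require Import all_classical all_reals all_analysis.

Set Implicit Arguments.
Unset Strict Implicit.
Unset Printing Implicit Defensive.

Import Order.TTheory GRing.Theory Num.Theory.
Import numFieldNormedType.Exports.

Local Open Scope classical_set_scope.
Local Open Scope ring_scope.

Section HausdorffDimension.
Variables (R : realType) (T : Type) (d : T -> T -> R).
Local Open Scope ereal_scope.

(* The diameter of the empty set is -oo here; [gauge] gives it weight 0. *)
Definition diam (A : set T) : \bar R :=
  ereal_sup [set (d p.1 p.2)%:E | p in A `*` A].

(* At s = 0 every nonempty set, even one of diameter 0, has weight 1. *)
Definition gauge (s : R) (A : set T) : \bar R :=
  if `[< A = set0 >] then 0 else diam A `^ s.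

Definition hausdorff_premeasure (s delta : R) (A : set T) : \bar R :=
  ereal_inf [set \sum_(0 <= k <oo) gauge s (U k) | U in
    [set U : nat -> set T | A `<=` \bigcup_k U k /\
                            forall k, diam (U k) <= delta%:E]].

Definition hausdorff_measure (s : R) (A : set T) : \bar R :=
  ereal_sup [set hausdorff_premeasure s delta A | delta in [set x | (0 < x)%R]].

Definition hausdorff_dim (A : set T) : \bar R :=
  ereal_inf [set s%:E | s in [set s : R | (0 <= s)%R /\
                                          hausdorff_measure s A = 0]].

End HausdorffDimension.

Definition euclidean_dist (R : realType) (n : nat) (x y : 'rV[R]_n) : R :=
  Num.sqrt (\sum_(i < n) (x 0 i - y 0 i) ^+ 2).

Section LinearForms.
Variables (R : realType) (n : nat).

Definition height (b : 'rV[int]_n) : nat := (\max_(i < n) `|b ord0 i|)%N.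

(* For n >= 1 and t >= 1 the infimum is over a nonempty set and is attained:
   only finitely many b are admissible, and for each of them the values tend
   to infinity with |b0|. *)
Definition psi (xi : 'rV[R]_n) (t : R) : R :=
  inf [set `| \sum_(i < n) xi 0 i * (b.1 0 i)%:~R + b.2%:~R | | b in
    [set b : 'rV[int]_n * int |
      (1 <= height b.1)%N /\ (height b.1)%:R <= t]].

Definition Theta (xi : 'rV[R]_n) : \bar R :=
  limf_esup (fun t : R => (t ^+ n * psi xi t)%:E) (pinfty_nbhs R).

Definition Theta_low (xi : 'rV[R]_n) : \bar R :=
  limf_einf (fun t : R => (t ^+ n * psi xi t)%:E) (pinfty_nbhs R).

Definition DI (c : R) : set 'rV[R]_n := [set xi | Theta xi = c%:E].

Definition Bad : set 'rV[R]_n := [set xi | (0 < Theta_low xi)%E].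

Definition Sing : set 'rV[R]_n := [set xi | Theta xi = 0%E].

Definition FS (c : R) : set 'rV[R]_n := DI c `\` (Bad `|` Sing).

End LinearForms.

(* Kleene's total recursive functions. [rec_min] is minimization restricted to
   functions g having a zero on every line, so that the result h is total. *)
Inductive recursive : forall k : nat, (k.-tuple nat -> nat) -> Prop :=
| rec_zero k : @recursive k (fun=> 0%N)
| rec_succ : @recursive 1 (fun v => (thead v).+1)
| rec_proj k (i : 'I_k) : @recursive k (fun v => tnth v i)
| rec_comp k m (f : m.-tuple nat -> nat) (g : 'I_m -> k.-tuple nat -> nat) :
    recursive f -> (forall i, recursive (g i)) ->
    @recursive k (fun v => f [tuple g i v | i < m])
| rec_prim k (f : k.-tuple nat -> nat) (g : k.+2.-tuple nat -> nat) :
    recursive f -> recursive g ->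
    @recursive k.+1 (fun v =>
      iteri (thead v) (fun j y => g [tuple of j :: y :: [tuple of behead v]])
            (f [tuple of behead v]))
| rec_min k (g : k.+1.-tuple nat -> nat) (h : k.-tuple nat -> nat) :
    recursive g ->
    (forall v, g [tuple of h v :: v] = 0%N) ->
    (forall v j, (j < h v)%N -> g [tuple of j :: v] <> 0%N) ->
    @recursive k h.

(* Computable sequence of real numbers, in the sense of computable analysis:
   from (n, k) one computes a rational number within 2^-k of u n. *)
Definition computable_seq (R : realType) (u : nat -> R) : Prop :=
  exists p q r : 2.-tuple nat -> nat,
    [/\ recursive p, recursive q, recursive r &
        forall n k : nat, let v := [tuple n; k] in
          `| u n - ((p v)%:R - (q v)%:R) / (r v).+1%:R | <= 2%:R ^- k].

(* Main.v *)
(** Idea. Write [n = m + 2].  Fix, once and for all, rationals [p_k/q_k -> x]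
    and [r_k/s_k -> y] with [q_0 <= s_0 < q_1 <= s_1 < ...], with all the
    relevant coprimality, such that [s_k^n (q_k x - p_k) -> c] while
    [q_(k+1)^n |s_k y - r_k| -> 0].  For every [zeta] in [R^m] the two families
    of forms [q_k x - p_k] and [s_k y - r_k] alone give [Theta <= c] and
    [Theta_low <= 0] at the point [(x, y, zeta)].  For [Theta >= c], consider an
    integer form of height less than [s_k]: its value at [(p_k/q_k, r_k/s_k)] in
    the first two variables is a fraction of denominator [q_k s_k].  If it does
    not involve [zeta] and this fraction vanishes, coprimality makes it a multiple
    of [q_k x - p_k].  If it involves [zeta], it is large unless
    [q_k s_k (b . zeta)] is within [4 c s_k^-m] of an integer; the probability
    that this occurs for some [b] is at most 1/2 when [c] is small.  Hence the
    set of [zeta] that are good for infinitely many [k] has positive measure,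
    and dimension at least [m]. *)
Require Import Defs.
From HB Require Import structures.
From mathcomp Require Import all_boot all_order all_algebra.
From mathcomp Require Import all_classical all_reals all_analysis measurable_realfun.
From mathcomp Require Import zify ring lra.

Set Implicit Arguments.
Unset Strict Implicit.
Unset Printing Implicit Defensive.

Import Order.TTheory GRing.Theory Num.Theory.
Import numFieldNormedType.Exports.
Local Open Scope ring_scope.
Local Open Scope classical_set_scope.

(** * The two sequences of rationals *)

(** The sequence [z] increases while [z k + 2 * d k] decreases, so the supremum [x] of [z] satisfies
    [z k <= x <= z k + 2 * d k] for every [k]. Reading this at [k.+1] gives the claim. *)
Lemma fast_series (R : realType) (z d : nat -> R) :
  (forall k, z k.+1 = z k + d k) -> (forall k, 0 < d k) ->
  (forall k, d k.+1 <= d k / 2) ->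
  exists x, forall k, d k <= x - z k <= d k + 2 * d k.+1.
Proof.
move=> hz d0 hd.
have zmono j k : (j <= k)%N -> z j <= z k.
  elim: k => [|k IH]; first by rewrite leqn0 => /eqP->.
  rewrite leq_eqVlt => /predU1P[->//|]; rewrite ltnS => /IH.
  by rewrite hz; have := d0 k; lra.
have zanti j k : (j <= k)%N -> z k + 2 * d k <= z j + 2 * d j.
  elim: k => [|k IH]; first by rewrite leqn0 => /eqP->.
  rewrite leq_eqVlt => /predU1P[->//|]; rewrite ltnS => /IH.
  by rewrite hz; have := hd k; lra.
have zub j k : z j <= z k + 2 * d k.
  have := zmono j (maxn j k) (leq_maxl _ _).
  have := zanti k (maxn j k) (leq_maxr _ _).
  by have := d0 (maxn j k); lra.
pose x := sup (range z).
have hub k : x <= z k + 2 * d k.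
  by apply: ge_sup; [exists (z 0%N), 0%N | move=> _ [j _ <-]].
have hlb k : z k <= x.
  apply: ub_le_sup; last by exists k.
  by exists (z 0%N + 2 * d 0%N) => _ [j _ <-].
exists x => k.
by have := hub k.+1; have := hlb k.+1; rewrite !hz => *; apply/andP; lra.
Qed.

Lemma sqr_le_exp3 m : (m ^ 2 <= 3 ^ m)%N.
Proof.
elim: m => // -[|[|m]]//.
by rewrite [(3 ^ m.+3)%N]expnS -!mulnn; nia.
Qed.

Lemma inv_half_le (R : realType) (a b : nat) : (0 < a)%N -> (2 * a <= b)%N ->
  1 / b%:R <= 1 / a%:R / 2 :> R.
Proof.
move=> a0 ab.
have a0' : 0 < a%:R :> R by rewrite ltr0n.
have ab' : 2 * a%:R <= b%:R :> R by rewrite -natrM ler_nat.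
by rewrite !div1r -invfM lef_pV2 ?posrE; lra.
Qed.

Section Denominators.
Variables (R : realType) (n : nat) (c : R).
Hypotheses (n3 : (3 <= n)%N) (c0 : 0 < c) (c4 : c <= 1 / 4).

Record convergents := Convergents { cq : nat; cp : nat; cs : nat; cr : nat }.

(* [3 * trunc (t / 3) + 1] is a nearby integer of [t] prime to 3. *)
Definition step_factor (u : convergents) : nat :=
  (3 * Num.truncn ((cs u)%:R ^+ n / (c * (cq u)%:R) / 3) + 1)%N.

(** Each fraction grows by the reciprocal of its new denominator: [p'/q' = p/q + 1/q'] and
    [r'/s' = r/s + 1/s']. Hence [q x - p] is about [q/q' = 1/(q w)], and [w] close to [s^n/(c q)]
    brings [s^n (q x - p)] close to [c]. Every [s] is a power of 3 and every [q] is prime to 3,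
    which keeps [q] and [s] coprime; the exponent [n q'] makes [s'/s] at least [q'^(n+1)]. *)
Definition step (u : convergents) : convergents :=
  let w := step_factor u in
  let q := (cq u ^ 2 * w)%N in
  let e := (3 ^ (n * q))%N in
  Convergents q (cp u * cq u * w + 1) (cs u * e) (cr u * e + 1).

Definition conv (k : nat) : convergents := iter k step (Convergents 1 0 3 1).

Local Notation q k := (cq (conv k)).
Local Notation p k := (cp (conv k)).
Local Notation s k := (cs (conv k)).
Local Notation r k := (cr (conv k)).
Local Notation w k := (step_factor (conv k)).

Lemma q_succ k : q k.+1 = (q k ^ 2 * w k)%N. Proof. by []. Qed.
Lemma p_succ k : p k.+1 = (p k * q k * w k + 1)%N. Proof. by []. Qed.
Lemma s_succ k : s k.+1 = (s k * 3 ^ (n * q k.+1))%N. Proof. by []. Qed.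
Lemma r_succ k : r k.+1 = (r k * 3 ^ (n * q k.+1) + 1)%N. Proof. by []. Qed.

Lemma coprime_mul_add1 a b : coprime (a * b + 1) b.
Proof. by rewrite coprime_sym addn1 /coprime -addn1 gcdnMDl gcdn1. Qed.

Lemma step_factor_gt0 k : (0 < w k)%N. Proof. by rewrite /step_factor addn1. Qed.

Lemma q_gt0 k : (0 < q k)%N.
Proof. by elim: k => // k IH; rewrite q_succ muln_gt0 expn_gt0 IH step_factor_gt0. Qed.

Lemma q_le_s k : (q k <= s k)%N.
Proof.
case: k => // k; rewrite s_succ.
have s0 : (0 < s k)%N.
  by elim: k => // k IH; rewrite s_succ muln_gt0 IH expn_gt0.
rewrite (leq_trans (ltnW (ltn_expl (q k.+1) (isT : 1 < 3)%N)))//.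
by rewrite (leq_trans _ (leq_pmull _ s0))// leq_pexp2l// leq_pmull//; lia.
Qed.

Lemma s_gt0 k : (0 < s k)%N.
Proof. exact: leq_trans (q_gt0 k) (q_le_s k). Qed.

Lemma coprime_q3 k : coprime (q k) 3.
Proof.
elim: k => // k IH; rewrite q_succ coprimeMl coprimeXl//=.
by rewrite /step_factor mulnC coprime_mul_add1.
Qed.

Lemma s_exp3 k : exists e, s k = (3 ^ e)%N.
Proof.
elim: k => [|k [e he]]; first by exists 1%N.
by exists (e + n * q k.+1)%N; rewrite s_succ he expnD.
Qed.

Lemma coprime_qs k : coprime (q k) (s k).
Proof. by have [e ->] := s_exp3 k; rewrite coprimeXr// coprime_q3. Qed.

Lemma coprime_pq k : coprime (p k) (q k).
Proof.
case: k => // k; rewrite p_succ q_succ -mulnn -!mulnA coprimeMr.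
by rewrite coprime_mul_add1 andbT mulnCA mulnC coprime_mul_add1.
Qed.

Lemma coprime_rs k : coprime (r k) (s k).
Proof.
have [e ->] := s_exp3 k; rewrite coprimeXr//.
case: k => // k; rewrite r_succ.
have : (0 < n * q k.+1)%N by rewrite muln_gt0 q_gt0 andbT; lia.
by case: (n * _)%N => // a _; rewrite expnSr mulnA coprime_mul_add1.
Qed.

Lemma step_factor_approx k : `|(w k)%:R - (s k)%:R ^+ n / (c * (q k)%:R)| <= 2.
Proof.
rewrite /step_factor; set N := (s k)%:R ^+ n / (c * (q k)%:R).
have N0 : 0 <= N / 3.
  by rewrite !divr_ge0// ?exprn_ge0 ?mulr_ge0// ltW.
have /andP[] := truncn_itv N0; move: (Num.truncn _) => t.
rewrite natrD natrM -(natr1 t) ler_norml => h1 h2.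
by apply/andP; split; lra.
Qed.

(** This is the rounding error of [step_factor] multiplied by [c q^2]. Divided by [q k.+1], it
    compares [s^n q / q k.+1], the main term of [s^n (q x - p)], with [c]. *)
Lemma q_succ_approx k : `|c * (q k.+1)%:R - (q k)%:R * (s k)%:R ^+ n| <= 2 * c * (q k)%:R ^+ 2.
Proof.
have q0 : 0 < (q k)%:R :> R by rewrite ltr0n q_gt0.
have -> : c * (q k.+1)%:R - (q k)%:R * (s k)%:R ^+ n =
   (c * (q k)%:R ^+ 2) * ((w k)%:R - (s k)%:R ^+ n / (c * (q k)%:R)).
  by rewrite q_succ natrM natrX; field; rewrite !gt_eqF.
rewrite normrM gtr0_norm; last by rewrite mulr_gt0// exprn_gt0.
by rewrite mulrC -mulrA ler_wpM2r ?step_factor_approx// ltW// mulr_gt0// exprn_gt0.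
Qed.

(** Since [c <= 1/4] and [n >= 3], [q s^n >= 4 c q s^3], while the error [2 c q^2] is at most
    [2 c q s^3]. So [c q k.+1 >= 2 c q s^3]. *)
Lemma q_growth k : (2 * q k * s k ^ 2 <= q k.+1)%N.
Proof.
have q0 : 1 <= (q k)%:R :> R by rewrite ler1n q_gt0.
have qs : (q k)%:R <= (s k)%:R :> R by rewrite ler_nat q_le_s.
have sn : (s k)%:R ^+ 3 <= (s k)%:R ^+ n :> R.
  by apply: ler_weXn2l => //; rewrite ler1n s_gt0.
have := q_succ_approx k; rewrite ler_norml => /andP[+ _].
rewrite -(ler_nat R) -mulnn; move: (q k.+1) => Q'; rewrite !natrM.
rewrite -(ler_pM2l c0).
set Q := (q k)%:R in q0 qs *; set S := (s k)%:R in qs sn *.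
move=> h.
have h1 : Q * S ^+ 3 <= Q * S ^+ n by rewrite ler_pM2l//; lra.
have h2 : S * S <= S ^+ 3 by nra.
have h3 : 0 <= (1 - 4 * c) * (Q * S ^+ 3).
  have h0 : 0 <= 1 - 4 * c by have := c4; lra.
  by rewrite mulr_ge0// mulr_ge0// ?exprn_ge0//; lra.
have Q0 : 0 <= Q by lra.
have cQ0 : 0 <= c * Q by rewrite mulr_ge0// ltW.
have h4 : c * Q * (S * S) <= c * Q * S ^+ 3 by rewrite ler_wpM2l.
have h5 : c * Q * Q <= c * Q * S ^+ 3 by rewrite ler_wpM2l//; nra.
nra.
Qed.

(** With [Q = q k.+1], [Q^(n+1) <= (Q^2)^n <= (3^Q)^n]. This domination of [s k.+1 / s k] over a
    power of [q k.+1] is what makes [q k.+1 ^ n * |s k y - r k|] tend to 0. *)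
Lemma expn_growth k : (q k.+1 ^ n.+1 <= 3 ^ (n * q k.+1))%N.
Proof.
move: (q k.+1) (q_gt0 k.+1) => Q Q0.
rewrite mulnC expnM (@leq_trans ((Q ^ 2) ^ n)%N)//.
  by rewrite -expnM leq_pexp2l//; lia.
by rewrite leq_exp2r ?sqr_le_exp3//; lia.
Qed.

Lemma exp3_ge2 k : (2 <= 3 ^ (n * q k.+1))%N.
Proof.
have : (0 < n * q k.+1)%N by rewrite muln_gt0 q_gt0 andbT; lia.
case: (n * _)%N => // a _; rewrite expnS.
by have := expn_gt0 3 a; lia.
Qed.

Lemma s_double k : (2 * s k <= s k.+1)%N.
Proof. by rewrite s_succ mulnC leq_mul2l exp3_ge2 orbT. Qed.

Lemma k_lt_s k : (k < s k)%N.
Proof. by elim: k => // k IH; rewrite s_succ; have := exp3_ge2 k; nia. Qed.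

Lemma p_ratio k : (p k.+1)%:R / (q k.+1)%:R =
  (p k)%:R / (q k)%:R + 1 / (q k.+1)%:R :> R.
Proof.
rewrite p_succ q_succ natrD !natrM; field.
by rewrite !pnatr_eq0 -!lt0n q_gt0 step_factor_gt0.
Qed.

Lemma r_ratio k : (r k.+1)%:R / (s k.+1)%:R =
  (r k)%:R / (s k)%:R + 1 / (s k.+1)%:R :> R.
Proof.
rewrite r_succ s_succ; have := s_gt0 k; have : (0 < 3 ^ (n * q k.+1))%N by rewrite expn_gt0.
move: (3 ^ _)%N (s k) => E S E0 S0; rewrite natrD !natrM; field.
by rewrite !pnatr_eq0 -!lt0n E0 S0.
Qed.

Lemma p_over_q_limit : exists x : R, forall k,
  1 / (q k.+1)%:R <= x - (p k)%:R / (q k)%:R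
    <= 1 / (q k.+1)%:R + 2 * (1 / (q k.+2)%:R).
Proof.
apply: (@fast_series R (fun k => (p k)%:R / (q k)%:R) (fun k => 1 / (q k.+1)%:R)).
- exact: p_ratio.
- by move=> k; rewrite divr_gt0// ltr0n q_gt0.
- move=> k; apply: inv_half_le; first exact: q_gt0.
  by rewrite (leq_trans _ (q_growth k.+1))//; have := s_gt0 k.+1; nia.
Qed.

Lemma r_over_s_limit : exists y : R, forall k,
  1 / (s k.+1)%:R <= y - (r k)%:R / (s k)%:R
    <= 1 / (s k.+1)%:R + 2 * (1 / (s k.+2)%:R).
Proof.
apply: (@fast_series R (fun k => (r k)%:R / (s k)%:R) (fun k => 1 / (s k.+1)%:R)).
- exact: r_ratio.
- by move=> k; rewrite divr_gt0// ltr0n s_gt0.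
- move=> k; apply: inv_half_le; first exact: s_gt0.
  exact: s_double.
Qed.

Lemma denominators_exist : exists (q s p r : nat -> nat) (x y : R), forall k,
  [/\ [/\ (0 < q k)%N, (q k <= s k)%N & (k < s k)%N],
      [/\ (s k < q k.+1)%N & (q k * s k <= q k.+1)%N],
      [/\ coprime (p k) (q k), coprime (r k) (s k) & coprime (q k) (s k)],
      0 < (q k)%:R * x - (p k)%:R &
      `|(s k)%:R ^+ n * ((q k)%:R * x - (p k)%:R) - c| <= 4 / (s k)%:R /\
      (q k.+1)%:R ^+ n * `|(s k)%:R * y - (r k)%:R| <= 3 / (q k.+1)%:R].
Proof.
have [x hx] := p_over_q_limit; have [y hy] := r_over_s_limit.
exists (fun k => q k), (fun k => s k), (fun k => p k), (fun k => r k), x, y => k.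
have q0 := q_gt0 k; have s0 := s_gt0 k; have qs := q_le_s k.
have g := q_growth k; have g' := q_growth k.+1.
have q0' := q_gt0 k.+1; have s0' := s_gt0 k.+1.
have q0R : 0 < (q k)%:R :> R by rewrite ltr0n.
have s0R : 1 <= (s k)%:R :> R by rewrite ler1n.
have q0R' : 0 < (q k.+1)%:R :> R by rewrite ltr0n.
have s0R' : 0 < (s k.+1)%:R :> R by rewrite ltr0n.
have gR : 2 * (q k)%:R * (s k)%:R ^+ 2 <= (q k.+1)%:R :> R.
  by rewrite -natrX -!natrM ler_nat.
have gR' : 2 * (q k.+1)%:R * (s k.+1)%:R ^+ 2 <= (q k.+2)%:R :> R.
  by rewrite -natrX -!natrM ler_nat.
have qsR : (q k)%:R <= (s k)%:R :> R by rewrite ler_nat.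
have ss : (s k)%:R <= (s k.+1)%:R :> R.
  by rewrite ler_nat s_succ leq_pmulr// expn_gt0.
have hq := q_succ_approx k.
have hk := hx k; have {}hy := hy k.
have q2R : 0 < (q k.+2)%:R :> R by rewrite ltr0n q_gt0.
have ss2 : 2 * (s k.+1)%:R <= (s k.+2)%:R :> R.
  by rewrite -natrM ler_nat s_double.
have hs1 : (s k.+1)%:R = (s k)%:R * (3 ^ (n * q k.+1))%:R :> R by rewrite -natrM.
have hexp : (q k.+1)%:R ^+ n * (q k.+1)%:R <= (3 ^ (n * q k.+1))%:R :> R.
  by rewrite -exprSr -natrX ler_nat expn_growth.
move: (coprime_pq k) (coprime_rs k) (coprime_qs k) (k_lt_s k) => c1 c2 c3 c5.
(* Only inequalities matter from here on: [Q], [Q1], [Q2] stand for three consecutive values of [q],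
   and [S], [S1], [S2] for those of [s]; [P] and [T] are the numerators, and [E] is the ratio
   [S1 / S]. *)
move: hq hk hy q2R gR' ss2 ss gR q0R' s0R' g hs1 hexp.
move: (s k.+2) (s k.+1) (q k.+2) => S2 S1 Q2.
move: (3 ^ _)%N => E; move: (q k.+1) => Q1.
move: q0 qs q0R s0R qsR c1 c2 c3 c5.
move: (q k) (p k) (s k) (r k) => Q P S T.
move=> q0 qs q0R s0R qsR c1 c2 c3 c5 hq hk hy q2R gR' ss2 ss gR q0R' s0R' g hs1 hexp.
have hL : Q%:R * x - P%:R = Q%:R * (x - P%:R / Q%:R) :> R.
  by field; rewrite gt_eqF.
have hM : S%:R * y - T%:R = S%:R * (y - T%:R / S%:R) :> R.
  by field; rewrite gt_eqF//; lra.
split; [by split| |by split| |].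
  by move: q0 qs g c5; clear; nia.
  rewrite hL mulr_gt0//; case/andP: hk => h _; apply: lt_le_trans h.
  by rewrite divr_gt0.
split.
  rewrite hL mulrCA mulrA; set A := Q%:R * S%:R ^+ n.
  set d := x - _ in hk *.
  have A0 : 0 < A by rewrite mulr_gt0// exprn_gt0//; lra.
  have S0 : 0 < S%:R :> R by lra.
  (* The deviation from [c] has two sources: rounding of the step factor costs at most [1/S] ([u1],
     [u4]), and the tail of the series for [x] at most [2/S] ([u3]). *)
  have u1 : 2 * c * Q%:R ^+ 2 / Q1%:R <= 1 / S%:R.
    rewrite ler_pdivrMr// [leRHS]mulrC [leRHS]mulrA mulr1 ler_pdivlMr// (le_trans _ gR)//.
    have QS0 : 0 < Q%:R * S%:R :> R by exact: mulr_gt0.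
    have h1 : Q%:R * S%:R * Q%:R <= Q%:R * S%:R * S%:R :> R by rewrite ler_pM2l.
    have h2 : c * (Q%:R * S%:R * Q%:R) <= 1 / 4 * (Q%:R * S%:R * Q%:R).
      by rewrite ler_wpM2r// mulr_ge0// ltW.
    have h3 : 0 <= Q%:R * S%:R * Q%:R :> R by rewrite mulr_ge0// ltW.
    by clear -h1 h2 h3; lra.
  have u2 : A <= 2 * Q1%:R.
    move: hq; rewrite ler_norml => /andP[h _].
    have : c * Q1%:R <= 1 / 4 * Q1%:R by rewrite ler_wpM2r// ltW.
    have : c * Q%:R ^+ 2 <= 1 / 4 * Q1%:R.
      rewrite ler_pM//; first exact: ltW.
      rewrite (le_trans _ gR)//.
      have h1 : Q%:R * Q%:R <= Q%:R * S%:R :> R by rewrite ler_pM2l.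
      have h2 : Q%:R * S%:R <= Q%:R * S%:R ^+ 2 :> R.
        by rewrite ler_pM2l// expr2 ler_peMl// ltW.
      have h3 : 0 < Q%:R * S%:R ^+ 2 :> R by rewrite mulr_gt0// exprn_gt0.
      by clear -h1 h2 h3; lra.
    by move: h; rewrite -/A; nra.
  have u3 : A * (2 * (1 / Q2%:R)) <= 2 / S%:R.
    rewrite 2!mulrA mulr1 ler_pdivrMr// [leRHS]mulrAC ler_pdivlMr//.
    have : A * S%:R <= 2 * Q1%:R * S1%:R ^+ 2.
      apply: ler_pM => //; try exact: ltW.
      by rewrite (le_trans ss)// expr2 ler_peMl ?(le_trans s0R)// ltW.
    have h1 := gR'; clear -h1; lra.
  have u4 : `|A / Q1%:R - c| <= 1 / S%:R.
    apply: le_trans u1.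
    have -> : A / Q1%:R - c = - ((c * Q1%:R - A) / Q1%:R).
      by field; rewrite gt_eqF.
    by rewrite normrN normrM (@gtr0_norm _ (_^-1)) ?invr_gt0// ler_pM2r ?invr_gt0.
  move: u4 hk; rewrite !ler_norml => /andP[v1 v2] /andP[w1 w2].
  have w1' : A / Q1%:R <= A * d by rewrite ler_pM2l// -div1r.
  have w2' : A * d <= A / Q1%:R + A * (2 * (1 / Q2%:R)).
    by rewrite -mulrDr ler_pM2l// -[_^-1]div1r.
  have S0' : 0 < 1 / S%:R :> R by rewrite divr_gt0.
  by apply/andP; split; lra.
have S0 : 0 < S%:R :> R by lra.
have E0 : 0 < E%:R :> R by move: s0R'; rewrite hs1 pmulr_rgt0.
rewrite hM ger0_norm; last first.
  rewrite mulr_ge0 ?ltW//; case/andP: hy => h _; apply: lt_le_trans h.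
  by rewrite divr_gt0.
(* As [s] at least doubles, the tail is no larger than the leading term. Multiplying by [S] leaves
   [2/E], and [E >= Q1^(n+1)] absorbs the factor [Q1^n]. *)
have {}hy : y - T%:R / S%:R <= 2 * (1 / S1%:R).
  case/andP: hy => _ h; apply: (le_trans h).
  have : 2 * (1 / S2%:R) <= 1 / S1%:R :> R.
    by rewrite mulrA mulr1 ler_pdivlMr// mulrAC ler_pdivrMr//; lra.
  lra.
have e1 : S%:R * (y - T%:R / S%:R) <= 2 / E%:R.
  apply: (@le_trans _ _ (S%:R * (2 * (1 / S1%:R)))); first by rewrite ler_pM2l.
  rewrite hs1 le_eqVlt; apply/orP; left; apply/eqP.
  by field; rewrite !gt_eqF.
apply: (@le_trans _ _ (Q1%:R ^+ n * (2 / E%:R))).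
  by rewrite ler_pM2l// exprn_gt0.
rewrite mulrA ler_pdivrMr// [leRHS]mulrAC ler_pdivlMr//; nra.
Qed.

End Denominators.

(** * Lower bound for an integer form of height less than [s] *)

(** Multiplied by [q s], the form becomes [A + q s g] plus corrections of size at most
    [s^2 L + q s tau], where the integer [A] is [q s] times the value at [(p/q, r/s)] without [g].
    If [|A + q s g| >= eta], at least [q s L] is left. This covers [g = 0] with [A != 0], as
    [eta <= 1]; for [A = 0] the form is an integer multiple of [q x - p]. *)
Lemma norm_form_ge (R : realType) (q s p r : nat) (x y L tau eta g : R)
    (b1 b2 b0 : int) :
  (0 < q)%N -> (0 < s)%N ->
  coprime p q -> coprime r s -> coprime q s ->
  q%:R * x - p%:R = L -> 0 < L -> `|s%:R * y - r%:R| <= tau ->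
  q%:R * s%:R * L + s%:R ^+ 2 * L + q%:R * s%:R * tau <= eta -> eta <= 1 ->
  (`|b1| < s)%N -> (`|b2| < s)%N ->
  (g = 0 /\ ((b1 != 0) || (b2 != 0))) \/
    (forall a : int, eta <= `|q%:R * s%:R * g + a%:~R|) ->
  L <= `|b1%:~R * x + b2%:~R * y + b0%:~R + g|.
Proof.
move=> q0 s0 cpq crs cqs hx L0 hy heta eta1 hb1 hb2 hg.
have q0' : 0 < q%:R :> R by rewrite ltr0n.
have s0' : 0 < s%:R :> R by rewrite ltr0n.
pose A : int := b1 * p%:Z * s%:Z + b2 * r%:Z * q%:Z + b0 * q%:Z * s%:Z.
set V := _ + g.
have VE : q%:R * s%:R * V =
    (A%:~R + q%:R * s%:R * g) + b1%:~R * s%:R * L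
    + q%:R * b2%:~R * (s%:R * y - r%:R).
  rewrite /V /A !rmorphD !rmorphM /= -!pmulrn -hx; ring.
have b1s : `|b1%:~R| <= s%:R :> R.
  by rewrite -intr_norm -natr_absz ler_nat; lia.
have b2s : `|b2%:~R| <= s%:R :> R.
  by rewrite -intr_norm -natr_absz ler_nat; lia.
have main : eta <= `|A%:~R + q%:R * s%:R * g| -> L <= `|V|.
  move=> hA.
  rewrite -(ler_pM2l (mulr_gt0 q0' s0')).
  have -> : q%:R * s%:R * `|V| = `|q%:R * s%:R * V|.
    by rewrite normrM (ger0_norm (ltW (mulr_gt0 q0' s0'))).
  have e1 : `|b1%:~R * s%:R * L| <= s%:R ^+ 2 * L.
    by rewrite !normrM (gtr0_norm L0) (gtr0_norm s0') ler_pM2r// expr2 ler_pM2r.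
  have e2 : `|q%:R * b2%:~R * (s%:R * y - r%:R)| <= q%:R * s%:R * tau.
    rewrite !normrM (gtr0_norm q0') -!mulrA ler_pM2l//.
    by apply: ler_pM.
  rewrite VE.
  have := ler_normD (A%:~R + q%:R * s%:R * g + b1%:~R * s%:R * L
    + q%:R * b2%:~R * (s%:R * y - r%:R)) (- (b1%:~R * s%:R * L
    + q%:R * b2%:~R * (s%:R * y - r%:R))).
  have := ler_normD (b1%:~R * s%:R * L) (q%:R * b2%:~R * (s%:R * y - r%:R)).
  rewrite normrN.
  have -> : A%:~R + q%:R * s%:R * g + b1%:~R * s%:R * L +
     q%:R * b2%:~R * (s%:R * y - r%:R) +
     - (b1%:~R * s%:R * L + q%:R * b2%:~R * (s%:R * y - r%:R)) =
     A%:~R + q%:R * s%:R * g by ring.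
  lra.
case: hg => [[g0 hb]|hg]; last by apply: main; rewrite addrC.
have [A0|A0] := eqVneq A 0; last first.
  apply: main; rewrite g0 mulr0 addr0 (le_trans eta1)// -intr_norm.
  by rewrite -natr_absz ler1n; move: A0; clear; lia.
(* From [A = 0], [s] divides [b2 r q], hence [b2] by coprimality, and [|b2| < s] leaves only 0. The
   same argument then shows that [q] divides [b1]. *)
have b20 : b2 = 0.
  have /dvdnP[k hk] : (s %| `|b2|)%N.
    rewrite -(@Gauss_dvdr s r) ?(coprime_sym s)// -(@Gauss_dvdl _ _ q); last first.
      by rewrite coprime_sym.
    have /eqP hE : b2 * r%:Z * q%:Z == - (b1 * p%:Z + b0 * q%:Z) * s%:Z.
      by rewrite -subr_eq0 -A0 /A; apply/eqP; ring.
    have -> : (r * absz b2 * q)%N = absz (b2 * r%:Z * q%:Z) by rewrite !abszM /= (mulnC r).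
    by rewrite hE abszM /= dvdn_mull.
  case: k hk hb2 => [|k] hk; first by move: hk; clear; lia.
  by rewrite hk mulSn -ltn_subRL subnn.
have hA : b1 * p%:Z + b0 * q%:Z = 0.
  apply/eqP; have : (b1 * p%:Z + b0 * q%:Z) * s%:Z == 0.
    by rewrite -A0 /A b20; apply/eqP; ring.
  by rewrite mulf_eq0 [s%:Z == 0]eqz_nat [s == _]eqn0Ngt s0 orbF.
have b10 : b1 != 0 by move: hb; rewrite b20 eqxx orbF.
have qb1 : (q <= `|b1|)%N.
  apply: dvdn_leq; first by rewrite absz_gt0.
  rewrite -(@Gauss_dvdl _ _ p) 1?coprime_sym//.
  have -> : (absz b1 * p)%N = absz (b1 * p%:Z) by rewrite abszM.
  have -> : b1 * p%:Z = - b0 * q%:Z by rewrite mulNr; apply/eqP; rewrite -addr_eq0 hA.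
  by rewrite abszM /= dvdn_mull.
have E : q%:R * V = b1%:~R * L.
  have : (b1 * p%:Z + b0 * q%:Z)%:~R = 0 :> R by rewrite hA.
  rewrite rmorphD !rmorphM /= -!pmulrn => hA'.
  rewrite /V g0 b20 -hx mul0r !addr0.
  by transitivity (b1%:~R * (q%:R * x - p%:R) + (b1%:~R * p%:R + b0%:~R * q%:R));
    [ring | rewrite hA' addr0].
rewrite -(ler_pM2l q0').
have -> : q%:R * `|V| = `|q%:R * V| by rewrite normrM (gtr0_norm q0').
rewrite E normrM (gtr0_norm L0) ler_pM2r//.
by rewrite -intr_norm -natr_absz ler_nat; lia.
Qed.

(** * Uniform approximation and the set FS *)

Section LimSup.
Variables (R : realType) (f : R -> R) (a : R).

Lemma limf_esup_pinfty_le (T : R) :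
  (forall t, T < t -> f t <= a) -> (limf_esup (fun t : R => (f t)%:E) (pinfty_nbhs R) <= a%:E)%E.
Proof.
move=> h; rewrite limf_esupE.
apply: (@le_trans _ _ (ereal_sup [set (f t)%:E | t in [set t : R | T < t]])).
  apply: ereal_inf_lbound; exists [set t : R | T < t] => //.
  by exists T; split => //; exact: num_real.
by apply: ge_ereal_sup => _ [t Tt <-]; rewrite lee_fin; exact: h.
Qed.

Lemma limf_esup_pinfty_ge :
  (forall T : R, exists2 t, T < t & a <= f t) ->
  (a%:E <= limf_esup (fun t : R => (f t)%:E) (pinfty_nbhs R))%E.
Proof.
move=> h; rewrite limf_esupE; apply: le_ereal_inf_tmp => _ [A [T [_ hT]] <-].
have [t Tt at_] := h T.
apply: (@le_trans _ _ (f t)%:E); first by rewrite lee_fin.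
by apply: ereal_sup_ubound; exists t => //; exact: hT.
Qed.

End LimSup.

Lemma limf_einf_pinfty_le (R : realType) (f : R -> R) (a : R) :
  (forall T : R, exists2 t, T < t & f t <= a) ->
  (limf_einf (fun t => (f t)%:E) (pinfty_nbhs R) <= a%:E)%E.
Proof.
move=> h; rewrite /limf_einf leeNl.
have -> : (\- (fun t : R => (f t)%:E))%E = (fun t => (- f t)%:E).
  by apply/funext => t; rewrite EFinN.
apply: limf_esup_pinfty_ge => T; have [t Tt ft] := h T.
by exists t => //; rewrite lerN2.
Qed.

Section Psi.
Variables (R : realType) (n : nat) (xi : 'rV[R]_n).
Local Notation form b := (`|\sum_(i < n) xi 0 i * (b.1 0 i)%:~R + b.2%:~R|).

Lemma psi_le (t : R) (b : 'rV[int]_n * int) :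
  (1 <= height b.1)%N -> (height b.1)%:R <= t -> psi xi t <= form b.
Proof.
move=> h1 h2; apply: ge_inf; last by exists b.
by exists 0 => _ [b' _ <-].
Qed.

Lemma psi_ge (t v : R) : (0 < n)%N -> 1 <= t ->
  (forall b : 'rV[int]_n * int, (1 <= height b.1)%N -> (height b.1)%:R <= t ->
     v <= form b) ->
  v <= psi xi t.
Proof.
move=> n0 t1 h; apply: lb_le_inf; last by move=> _ [b [b1 b2] <-]; exact: h.
(* A lower bound passes to [inf] only over a nonempty set. The vector of ones has height 1, so it is
   admissible for every [t >= 1]. *)
pose b : 'rV[int]_n := \row_j 1.
have hb : height b = 1%N.
  apply/eqP; rewrite eqn_leq; apply/andP; split.
    by apply/bigmax_leqP => i _; rewrite mxE.
  by apply: leq_trans (leq_bigmax (Ordinal n0)); rewrite mxE.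
by eexists; exists (b, 0) => //=; rewrite hb.
Qed.

End Psi.

Lemma bernoulli (R : realDomainType) (x : R) n : 0 <= x <= 1 ->
  1 - n%:R * x <= (1 - x) ^+ n.
Proof.
move=> /andP[x0 x1]; elim: n => [|n IH]; first by rewrite mul0r subr0 expr0.
rewrite exprS.
have h1 : (1 - x) * (1 - n%:R * x) <= (1 - x) * (1 - x) ^+ n.
  by rewrite ler_wpM2l//; lra.
have h2 : 0 <= n%:R * (x * x) by rewrite mulr_ge0// mulr_ge0.
by apply: le_trans h1; rewrite -natr1; lra.
Qed.

(** The bound [M k] serves on [[s k, q k.+1]] and contributes [o(1)]; the bound [L k.+1] serves on
    the rest of [[s k, s k.+1)] and contributes at most [c + o(1)]. Just below [s k], for infinitely
    many [k], the value [L k] is a lower bound, so [Theta xi = c], whereas at [t = s k] the product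
    tends to 0. *)
Lemma FS_criterion (R : realType) (n : nat) (xi : 'rV[R]_n) (c : R)
    (q s : nat -> nat) (L M : nat -> R) :
  0 < c -> c <= 1 ->
  (forall k, [/\ (q k <= s k)%N, (k < s k)%N & (s k < q k.+1)%N]) ->
  (forall k, 0 <= L k /\ 0 <= M k) ->
  (forall k, `|(s k)%:R ^+ n * L k - c| <= 4 / (s k)%:R) ->
  (forall k, (q k.+1)%:R ^+ n * M k <= 3 / (q k.+1)%:R) ->
  (forall k (t : R), (q k)%:R <= t -> psi xi t <= L k) ->
  (forall k (t : R), (s k)%:R <= t -> psi xi t <= M k) ->
  (forall K, exists2 k, (K <= k)%N &
     forall t, 1 <= t -> t < (s k)%:R -> L k <= psi xi t) ->
  FS c xi.
Proof.
move=> c0 c1 hqs LM0 hL hM psiL psiM hlow.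
have ks k : (k.+1)%:R <= (s k)%:R :> R by rewrite ler_nat; have [] := hqs k.
have sq k : (s k)%:R <= (q k.+1)%:R :> R by rewrite ler_nat ltnW//; have [] := hqs k.
have s0 k : 0 < (s k)%:R :> R by apply: lt_le_trans (ks k).
have q0 k : 0 < (q k.+1)%:R :> R by apply: lt_le_trans (sq k).
have L0 k : 0 <= L k by have [] := LM0 k.
have M0 k : 0 <= M k by have [] := LM0 k.
have smono j k : (j <= k)%N -> (s j <= s k)%N.
  elim: k => [|k IH]; first by rewrite leqn0 => /eqP->.
  rewrite leq_eqVlt => /predU1P[->//|]; rewrite ltnS => /IH h.
  have [_ _ h1] := hqs k; have [h2 _ _] := hqs k.+1.
  by rewrite (leq_trans h)// (leq_trans (ltnW h1)).
have large (T : R) : exists K, forall k, (K <= k)%N -> T < (s k)%:R.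
  exists (Num.truncn `|T|) => k Kk.
  have /andP[_ h] := truncn_itv (normr_ge0 T).
  apply: le_lt_trans (ler_norm T) _; apply: (lt_le_trans h).
  by apply: le_trans (ks k); rewrite ler_nat ltnS.
have small (B e : R) : 0 < e -> exists K, forall k, (K <= k)%N -> B / (s k)%:R <= e.
  move=> e0; have [K hK] := large (B / e); exists K => k /hK/ltW.
  by rewrite !ler_pdivrMr// mulrC.
have psi_bound (t T v : R) : 0 <= t -> t <= T -> 0 <= v -> psi xi t <= v ->
    t ^+ n * psi xi t <= T ^+ n * v.
  move=> t0 tT v0 h; apply: (@le_trans _ _ (t ^+ n * v)).
    by rewrite ler_wpM2l// exprn_ge0.
  by rewrite ler_wpM2r// lerXn2r// nnegrE// (le_trans t0).
have psiM' k (t : R) : (s k)%:R <= t -> t <= (q k.+1)%:R ->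
    t ^+ n * psi xi t <= 3 / (s k)%:R.
  move=> st tq; have t0 : 0 <= t by apply: le_trans st; exact: ltW.
  apply: le_trans (psi_bound _ _ _ t0 tq (M0 k) (psiM k t st)) _.
  apply: (le_trans (hM k)).
  by rewrite ler_pM2l// lef_pV2 ?posrE.
have ThetaE : Theta xi = c%:E.
  apply/eqP; rewrite eq_le; apply/andP; split; apply/lee_addgt0Pr => e e0.
    have [K hK] := small 4 e e0.
    rewrite -EFinD; apply: (@limf_esup_pinfty_le _ _ _ (s K)%:R) => t Kt.
    (* The least such [j] places [t] in a window [[s (j-1), s j)]; [j] is positive because it
       exceeds [K]. *)
    have ex : exists j, t < (s j)%:R.
      by have [j /(_ _ (leqnn _)) hj] := large t; exists j.
    have [] := ex_minnP ex => j tj minj.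
    have Kj : (K < j)%N.
      rewrite ltnNge; apply/negP => /smono.
      by rewrite -(ler_nat R) => /(lt_le_trans tj)/lt_trans/(_ Kt); rewrite ltxx.
    case: j tj minj Kj => // j tj minj; rewrite ltnS => Kj.
    have sjt : (s j)%:R <= t.
      by rewrite leNgt; apply/negP => /minj; rewrite ltnn.
    have t0 : 0 <= t by apply: le_trans sjt; exact: ltW.
    have [tq|tq] := leP t (q j.+1)%:R.
      apply: (le_trans (psiM' _ _ sjt tq)).
      have h1 : 3 / (s j)%:R <= 4 / (s j)%:R :> R by rewrite ler_pM2r ?invr_gt0//; lra.
      by have h2 := hK j Kj; lra.
    apply: le_trans (psi_bound _ _ _ t0 (ltW tj) (L0 _) (psiL _ _ (ltW tq))) _.
    have := hL j.+1; rewrite ler_norml => /andP[_ h].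
    by have := hK j.+1 (leq_trans Kj (leqnSn _)); lra.
  (* Write [A = s^n L k]. Then [A >= c - 4/s], and [A <= 5] because [c <= 1] and [s >= 1]. Sampling
     at [s - 1] instead of [s] loses at most [n A / s <= 5 n / s] by Bernoulli, for a total loss of
     [(5 n + 4) / s]. *)
  have [K1 hK1] := small (5 * n%:R + 4) e e0.
  rewrite -leeBlDr// -EFinB; apply: limf_esup_pinfty_ge => T.
  have [K2 hK2] := large (`|T| + 2).
  have [k Kk lowk] := hlow (maxn K1 K2).
  have {}hK1 := hK1 k (leq_trans (leq_maxl _ _) Kk).
  have {}hK2 := hK2 k (leq_trans (leq_maxr _ _) Kk).
  have hT := ler_norm T; have hT' := normr_ge0 T.
  (* The lower bound on [psi] holds only for [t] strictly below [s k]; the margin 2 in [hK2] gives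
     both [T < s k - 1] and [1 <= s k - 1]. *)
  exists ((s k)%:R - 1); first by lra.
  have lo : L k <= psi xi ((s k)%:R - 1) by apply: lowk; lra.
  apply: (@le_trans _ _ (((s k)%:R - 1) ^+ n * L k)); last first.
    by rewrite ler_wpM2l// exprn_ge0//; lra.
  have -> : (s k)%:R - 1 = (1 - 1 / (s k)%:R) * (s k)%:R :> R.
    by field; rewrite gt_eqF.
  rewrite exprMn -mulrA.
  have := hL k; rewrite ler_norml => /andP[h1 _].
  set A := _ * L k in h1 *.
  have A0 : 0 <= A by rewrite mulr_ge0// exprn_ge0// ltW.
  have is0 : 0 < 1 / (s k)%:R :> R by rewrite divr_gt0.
  have is1 : 1 / (s k)%:R <= 1 :> R by rewrite ler_pdivrMr// mul1r; lra.
  have hb : 1 - n%:R * (1 / (s k)%:R) <= (1 - 1 / (s k)%:R) ^+ n :> R.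
    by apply: bernoulli; rewrite (ltW is0).
  have hBA : (1 - n%:R * (1 / (s k)%:R)) * A <= (1 - 1 / (s k)%:R) ^+ n * A.
    by rewrite ler_wpM2r.
  apply: le_trans hBA.
  have := hL k; rewrite ler_norml => /andP[_ h2]; rewrite -/A in h2.
  have e4 : 4 / (s k)%:R = 4 * (1 / (s k)%:R) :> R by rewrite mulrA mulr1.
  have e5 : (5 * n%:R + 4) / (s k)%:R =
      n%:R * (1 / (s k)%:R) * 5 + 4 * (1 / (s k)%:R) :> R.
    by field; rewrite gt_eqF.
  rewrite e4 in h1 h2; rewrite e5 in hK1.
  have nA : n%:R * (1 / (s k)%:R) * A <= n%:R * (1 / (s k)%:R) * 5.
    apply: ler_wpM2l; last by lra.
    by rewrite mulr_ge0// ltW.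
  by rewrite mulrBl mul1r; lra.
split; [exact: ThetaE|].
case=> [|]; last first.
  by rewrite /Sing /= ThetaE => -[]; apply/eqP; rewrite gt_eqF.
rewrite /Bad /= ltNge => /negP; apply.
apply/lee_addgt0Pr => e e0; rewrite add0e.
apply: limf_einf_pinfty_le => T.
have [K hK] := small 3 e e0; have [K2 hK2] := large T.
pose k := maxn K K2.
exists (s k)%:R; first exact: hK2 (leq_maxr _ _).
apply: le_trans (hK k (leq_maxl _ _)).
exact: psiM'.
Qed.

(** * A product probability on the cube *)

Lemma uniform01_interval (R : realType) (u v : R) : u <= v ->
  (uniform_prob (@ltr01 R) `[u, v] <= (v - u)%:E)%E.
Proof.
move=> uv; rewrite /uniform_prob integral_uniform_pdf.
have mI : measurable (`[u, v] `&` `[0, 1] : set R) by exact: measurableI.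
rewrite (eq_integral (cst 1%E)); last first.
  move=> x; rewrite inE => -[_ /=]; rewrite in_itv /= => x01.
  by rewrite /uniform_pdf x01 subr0 invr1.
rewrite integral_cst// mul1e.
apply: (@le_trans _ _ (lebesgue_measure (`[u, v] : set R))).
  by apply: le_measure; rewrite ?inE//; exact: subIsetl.
rewrite lebesgue_measure_itv /= lte_fin; case: ifPn => // _.
by rewrite lee_fin subr_ge0.
Qed.

Lemma uniform01_setC (R : realType) :
  uniform_prob (@ltr01 R) (~` `[0, 1]) = 0%E.
Proof.
by rewrite /uniform_prob integral_uniform_pdf setICl integral_set0.
Qed.

Lemma measurable_slab d (T : measurableType d) (R : realType) (f : T -> R) (eta : R) :
  measurable_fun setT f ->
  measurable [set t | exists a : int, `|f t + a%:~R| < eta].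
Proof.
move=> mf.
have -> : [set t | exists a : int, `|f t + a%:~R| < eta] =
    \bigcup_(a : int) [set t | `|f t + a%:~R| < eta].
  by apply/seteqP; split=> [t [a h]|t [a _ h]]; exists a.
apply: countable_bigcupT_measurable => [|a]; first exact: countableP.
rewrite -[X in measurable X]setTI.
have -> : [set t | `|f t + a%:~R| < eta] =
  (fun t => `|f t + a%:~R|) @^-1` [set x | x < eta] by [].
have mg : measurable_fun setT (fun t => `|f t + a%:~R|).
  apply: measurableT_comp; first by [].
  exact: measurable_funD.
apply: mg => //.
by rewrite -set_itvNyo.
Qed.

(** For [g > 0] the part of the set in [[0, 1]] is covered by [g + 2] intervals of length
    [2 eta / g], and [2 eta (g + 2) / g <= 6 eta]. The sign of [g] is reversed by negating the
    form. *)
Lemma uniform01_slab (R : realType) (g : int) (theta eta : R) :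
  g != 0 -> 0 < eta ->
  (uniform_prob (@ltr01 R)
    [set x | exists a : int, (`|g%:~R * x + theta + a%:~R| < eta)%R]
    <= (6 * eta)%:E)%E.
Proof.
wlog g0 : g theta / (0 < g)%R.
  move=> H gn0 eta0; case: (ltgtP 0%R g) gn0 => // gs _; first by apply: H; rewrite ?gt_eqF.
  have -> : [set x : R | exists a : int, (`|g%:~R * x + theta + a%:~R| < eta)%R] =
      [set x | exists a : int, (`|(- g)%:~R * x - theta + a%:~R| < eta)%R].
    have E x (a : int) : (- g)%:~R * x - theta + a%:~R =
        - (g%:~R * x + theta + (- a)%:~R) by rewrite !rmorphN /=; ring.
    apply/seteqP; split=> x [a h]; exists (- a).
      by rewrite E normrN opprK.
    by rewrite -normrN -E.
  by apply: H => //; rewrite ?oppr_eq0 ?oppr_gt0// lt_eqF.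
move=> _ eta0; set A := (X in uniform_prob _ X).
have mA : measurable A.
  have mf : measurable_fun [set: measurableTypeR R]
      (fun x : measurableTypeR R => g%:~R * x + theta : R).
    by apply: measurable_funD => //; apply: measurable_funM.
  exact: (measurable_slab eta mf).
have [eta6|eta6] := leP 1 (6 * eta).
  by apply: (le_trans (@probability_le1 _ _ _ (uniform_prob (@ltr01 R)) A mA)); rewrite lee_fin.
pose N := `|g|%N.+2.
have g0' : 1 <= g%:~R :> R by rewrite ler1z.
(* For [x] in [[0, 1]] the integer [-a] lies strictly between [f] and [f + g + 2], the upper bound
   using [2 eta < 1]; so [j = -a - f - 1] is a valid index below [N]. *)
pose f := Num.floor (theta - eta).
pose F (j : nat) : set R :=
  `[((f + 1 + j%:Z)%:~R - theta - eta) / g%:~R,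
    ((f + 1 + j%:Z)%:~R - theta + eta) / g%:~R].
have sub : A `<=` ~` `[0, 1] `|` \big[setU/set0]_(j < N) F j.
  move=> x [a ha]; have [x01|x01] := pselect (`[(0:R), 1] x); [right|by left].
  move: x01; rewrite /= in_itv /= => /andP[x0 x1].
  rewrite -bigcup_mkord.
  have f1 := ge_floor (theta - eta); have f2 := lt_succ_floor (theta - eta).
  rewrite -/f rmorphD in f1 f2.
  move: ha; rewrite ltr_norml => /andP[h1 h2].
  have u1 : 0 <= g%:~R * x by rewrite mulr_ge0//; lra.
  have u2 : g%:~R * x <= g%:~R by rewrite ler_piMr//; lra.
  have l1 : f < - a by rewrite -(ltr_int R) rmorphN /=; lra.
  have l2 : - a < f + g + 2.
    by rewrite -(ltr_int R) !rmorphD rmorphN /=; lra.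
  exists (absz (- a - f - 1)%R); first by move: l1 l2 g0; rewrite /= /N; clear; lia.
  rewrite /F /= in_itv /=.
  have -> : f + 1 + (absz (- a - f - 1)%R)%:Z = - a by move: l1; clear; lia.
  rewrite ler_pdivrMr; last lra.
  rewrite ler_pdivlMr; last lra.
  by rewrite rmorphN /= mulrC; apply/andP; split; lra.
have mF j : measurable (F j) by exact: measurable_itv.
have mFU : measurable (\big[setU/set0]_(j < N) F j).
  by apply: bigsetU_measurable => j _; exact: mF.
apply: (@le_trans _ _ (uniform_prob (@ltr01 R) (~` `[0, 1] `|` \big[setU/set0]_(j < N) F j))).
  apply: le_measure; rewrite ?inE//.
  by apply: measurableU => //; apply: measurableC.
apply: (le_trans (measureU2 _ _ _)) => //; first exact: measurableC.
rewrite [X in (X + _)%E](_ : _ = 0%E); last exact: uniform01_setC.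
rewrite add0e.
apply: (le_trans (Boole_inequality _ _)); first by move=> i _; exact: mF.
apply: (@le_trans _ _ (\sum_(j < N) (2 * eta / g%:~R)%:E)%E).
  apply: lee_sum => j _.
  apply: (le_trans (uniform01_interval _)).
    by rewrite ler_pM2r ?invr_gt0; lra.
  by rewrite lee_fin le_eqVlt; apply/orP; left; apply/eqP; field; rewrite gt_eqF; lra.
rewrite sumEFin lee_fin sumr_const card_ord -(mulr_natr _ N) mulrAC.
rewrite ler_pdivrMr; last lra.
have -> : N%:R = g%:~R + 2 :> R.
  by rewrite /N -addn2 natrD natr_absz gtr0_norm.
have h : 0 <= eta * (g%:~R - 1) by rewrite mulr_ge0; lra.
lra.
Qed.

Lemma measurable_box d (T : measurableType d) (R : realType) (z : nat -> T -> R)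
    (a : nat -> R) (m : nat) (e : R) :
  (forall i, measurable_fun setT (z i)) ->
  measurable [set t | forall i, (i < m)%N -> `|z i t - a i| <= e].
Proof.
move=> mz.
have -> : [set t | forall i, (i < m)%N -> `|z i t - a i| <= e] =
    \bigcap_(i in [set i | (i < m)%N]) ((fun t => `|z i t - a i|) @^-1` `]-oo, e]).
  apply/seteqP; split=> [t h i im|t h i im].
    by rewrite /= in_itv /=; exact: h.
  by have := h i im; rewrite /= in_itv.
apply: bigcap_measurableType => i _.
rewrite -[X in measurable X]setTI.
have mg : measurable_fun setT (fun t => `|z i t - a i|).
  by apply: measurableT_comp => //; exact: measurable_funB.
by apply: mg.
Qed.

(** A model of the uniform point of the cube, built one coordinate at a time as a product. For the
    slab bound it suffices to randomize one coordinate with a nonzero coefficient: all the others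
    only shift [theta]. *)
Lemma cube_probability (R : realType) (m : nat) :
  exists (d : measure_display) (T : measurableType d) (P : probability T R)
    (z : nat -> T -> R),
  [/\ forall i, measurable_fun setT (z i),
      forall (a : nat -> R) (e : R), 0 <= e ->
        (P [set t | forall i, (i < m)%N -> (`|z i t - a i| <= e)%R]
          <= ((2 * e) ^+ m)%:E)%E &
      forall (g : nat -> int), (exists2 i, (i < m)%N & g i != 0) ->
        forall theta eta, 0 < eta ->
        (P [set t | exists a : int,
             (`|\sum_(i < m) (g i)%:~R * z i t + theta + a%:~R| < eta)%R]
          <= (6 * eta)%:E)%E].
Proof.
elim: m => [|m [d [T [P [z [mz box slab]]]]]].
  exists _, (measurableTypeR R), (uniform_prob (@ltr01 R)), (fun _ _ => 0).
  split=> [i|a e e0|g [i]]; [exact: measurable_cst| |by []].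
  by rewrite expr0; apply: probability_le1; exact: measurable_box.
pose U : probability (measurableTypeR R) R := uniform_prob (@ltr01 R).
pose z' (i : nat) (t : measurableTypeR R * T) : R :=
  if i is j.+1 then z j t.2 else t.1.
have mz' i : measurable_fun setT (z' i).
  case: i => [|i]; first exact: measurable_fst.
  by apply: (measurableT_comp (mz i)); exact: measurable_snd.
exists _, (measurableTypeR R * T)%type, (U \x P)%E, z'; split=> //.
- move=> a e e0.
  set B := [set t | forall i, (i < m)%N -> `|z i t - a i.+1| <= e].
  have -> : [set t | forall i, (i < m.+1)%N -> `|z' i t - a i| <= e] =
      `[a 0%N - e, a 0%N + e] `*` B.
    apply/seteqP; split=> [[x t] h|[x t] [/= h1 h2] [|i] im].
    - split; last by move=> i im; exact: (h i.+1).
      by have := h 0%N (ltn0Sn _); rewrite /= in_itv /= ler_distl.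
    - by move: h1; rewrite in_itv /= ler_distl.
    - exact: h2.
  have mB : measurable B by exact: (measurable_box (fun i => a i.+1)).
  rewrite [leLHS](_ : _ = (U `[(a 0%N - e)%R, (a 0%N + e)%R]%classic * P B)%E); last first.
    by apply: product_measure1E.
  rewrite exprS EFinM.
  apply: lee_pmul => //; last exact: box.
  apply: (le_trans (uniform01_interval _)); first lra.
  by rewrite lee_fin; lra.
- move=> g hg theta eta eta0.
  set A := [set t | _].
  have mA : measurable A.
    apply: (@measurable_slab _ _ _ (fun t => \sum_(i < m.+1) (g i)%:~R * z' i t + theta)).
    apply: measurable_funD => //; apply: measurable_sum => i.
    by apply: measurable_funM.
  (* If the new coordinate has coefficient 0, each section at fixed [x] is a slab in dimension [m].
     Otherwise each section at fixed [t] is a one-dimensional slab. *)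
  have [g0|g0] := eqVneq (g 0%N) 0.
    have {}hg : exists2 i, (i < m)%N & g i.+1 != 0.
      by case: hg => -[|i] im gi; [rewrite g0 in gi|exists i].
    apply: (@le_trans _ _ (\int[U]_x (cst (6 * eta)%:E x))%E); last first.
      by rewrite integral_cst// [X in (_ * X)%E](_ : _ = 1%E) ?mule1//; exact: probability_setT.
    apply: ge0_le_integral => //.
      exact: measurable_fun_xsection.
    move=> x _ /=.
    rewrite (_ : xsection A x = [set t | exists a : int,
       (`|\sum_(i < m) (g i.+1)%:~R * z i t + theta + a%:~R| < eta)%R]).
      exact: (slab (fun i => g i.+1)).
    apply/seteqP; split=> t; rewrite /xsection /= inE => -[a h]; exists a;
      by move: h; rewrite big_ord_recl /= g0 mul0r add0r.
  (* Sections at fixed [t] require integrating in the other order; uniqueness of the product measure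
     identifies the two iterated integrals. *)
  rewrite [leLHS](_ : _ = (U \x^ P)%E A); last first.
    apply: (@product_measure_unique _ _ _ _ _ U P (U \x^ P)%E) => //.
    by move=> *; exact: product_measure2E.
  apply: (@le_trans _ _ (\int[P]_x (cst (6 * eta)%:E x))%E); last first.
    by rewrite integral_cst// [X in (_ * X)%E](_ : _ = 1%E) ?mule1//; exact: probability_setT.
  apply: ge0_le_integral => //.
    exact: measurable_fun_ysection.
  move=> t _ /=.
  rewrite (_ : ysection A t = [set x | exists a : int,
     (`|(g 0%N)%:~R * x + (\sum_(i < m) (g i.+1)%:~R * z i t + theta) + a%:~R| < eta)%R]).
    exact: uniform01_slab.
  apply/seteqP; split=> x; rewrite /ysection /= inE => -[a h]; exists a;
    by move: h; rewrite big_ord_recl /= !addrA.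
Qed.

(** * A mass distribution principle *)

(** A nonempty [U] of diameter [D] lies in the ball of radius [D] about any of its points, and
    [D^m <= D^s] since [D <= 1] and [s < m]. The measurable set [B] replaces the preimage of [U],
    which may fail to be measurable. *)
Lemma diam_cover_bound (R : realType) (d : measure_display) (T : measurableType d)
    (P : {measure set T -> \bar R}) (n m : nat) (X : T -> 'rV[R]_n) (C s : R)
    (U : set 'rV[R]_n) :
  0 <= C -> 0 <= s -> s < m%:R ->
  (forall (v : 'rV[R]_n) (e : R), 0 <= e -> exists B : set T,
     [/\ measurable B, [set t | euclidean_dist (X t) v <= e] `<=` B &
         (P B <= (C * e ^+ m)%:E)%E]) ->
  (diam (@euclidean_dist R n) U <= 1%:E)%E ->
  exists B : set T, [/\ measurable B, X @^-1` U `<=` B &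
    (P B <= C%:E * gauge (@euclidean_dist R n) s U)%E].
Proof.
move=> C0 s0 sm hP dU; rewrite /gauge; case: asboolP => [->|/eqP/set0P[v Uv]].
  by exists set0; split=> //; rewrite measure0 mule0.
have ub u : U u -> ((euclidean_dist u v)%:E <= diam (@euclidean_dist R n) U)%E.
  by move=> Uu; apply: ereal_sup_ubound; exists (u, v).
have D0 : (0 <= diam (@euclidean_dist R n) U)%E.
  by apply: le_trans (ub v Uv); rewrite lee_fin sqrtr_ge0.
case: (diam _ _) dU ub D0 => [D| |]// D1 ub D0.
rewrite lee_fin in D1; rewrite lee_fin in D0.
have [B [mB sB PB]] := hP v D D0.
exists B; split=> //; first by move=> t /ub; rewrite lee_fin => /sB.
apply: (le_trans PB); rewrite poweR_EFin -EFinM lee_fin ler_wpM2l//.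
have m0 : (0 < m)%N by rewrite -(ltr_nat R); apply: le_lt_trans sm.
move: D0; rewrite le_eqVlt => /predU1P[<-|D0].
  by rewrite expr0n -[m == 0%N]negbK -lt0n m0 /= powR_ge0.
by rewrite -powR_mulrn ?(ltW D0)// ger_powR ?D0// ltW.
Qed.

(** If the [s]-dimensional measure of [A] vanished for some [s < m], a cover of [A] of tiny total
    weight would pull back to a cover of [E] of total probability less than [P E]. *)
Lemma mass_distribution (R : realType) (d : measure_display) (T : measurableType d)
    (P : probability T R) (n m : nat) (X : T -> 'rV[R]_n) (C : R) (E : set T)
    (A : set 'rV[R]_n) :
  0 <= C ->
  (forall (v : 'rV[R]_n) (e : R), 0 <= e -> exists B : set T,
     [/\ measurable B, [set t | euclidean_dist (X t) v <= e] `<=` B &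
         (P B <= (C * e ^+ m)%:E)%E]) ->
  measurable E -> (0 < P E)%E -> E `<=` X @^-1` A ->
  (m%:R%:E <= hausdorff_dim (@euclidean_dist R n) A)%E.
Proof.
move=> C0 hP mE PE EA; apply: le_ereal_inf_tmp => _ [s [s0 HsA] <-].
rewrite lee_fin leNgt; apply/negP => sm.
have [p p0 pE] : exists2 p, 0 < p & P E = p%:E.
  exists (fine (P E)); last by rewrite fineK ?fin_num_measure.
  by apply: fine_gt0; rewrite PE ltey_eq fin_num_measure.
(* Chosen so that [C * e < p], including when [C = 0]. *)
pose e := p / (C + 1).
have e0 : 0 < e by rewrite divr_gt0//; lra.
have pre0 : (hausdorff_premeasure (@euclidean_dist R n) s 1 A < e%:E)%E.
  apply: (@le_lt_trans _ _ 0%E); last by rewrite lte_fin.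
  by rewrite -HsA; apply: ereal_sup_ubound; exists 1 => //=.
have [_ [U [AU dU] <-] sume] := ereal_inf_lt pre0.
have /choice[B hB] : forall k, exists B : set T, [/\ measurable B, X @^-1` U k `<=` B &
    (P B <= C%:E * gauge (@euclidean_dist R n) s (U k))%E].
  by move=> k; apply: (diam_cover_bound (m := m)).
have mB k : measurable (B k) by have [] := hB k.
have EB : E `<=` \bigcup_k B k.
  move=> t /EA /AU[k _ Uk]; exists k => //.
  by have [_ + _] := hB k; apply.
have g0 k : (0 <= gauge (@euclidean_dist R n) s (U k))%E.
  by rewrite /gauge; case: ifP => // _; exact: poweR_ge0.
have := measure_sigma_subadditive P mB mE EB.
apply/negP; rewrite -ltNge.
apply: (@le_lt_trans _ _ (\sum_(0 <= k <oo) (C%:E * gauge (@euclidean_dist R n) s (U k)))%E).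
  by apply: lee_nneseries => // k _; have [] := hB k.
rewrite nneseriesZl//.
apply: (@le_lt_trans _ _ (C * e)%:E).
  by rewrite EFinM lee_wpmul2l ?lee_fin// ltW.
rewrite [ltRHS]pE lte_fin /e mulrA ltr_pdivrMr; last lra.
by rewrite mulrDr mulr1 mulrC; lra.
Qed.

(** * Computability of the constant *)

(** The constructors of [recursive] produce functions of a fixed shape; extensionality carries the
    property over to the intended expressions. *)
Lemma recursive_ext k (f g : k.-tuple nat -> nat) :
  recursive f -> (forall v, f v = g v) -> recursive g.
Proof. by move=> rf /funext <-. Qed.

Lemma recursive_const k a : recursive (fun _ : k.-tuple nat => a).
Proof.
elim: a => [|a IH]; first exact: rec_zero.
apply: recursive_ext (rec_comp rec_succ (fun i : 'I_1 => IH)) _ => v.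
by rewrite /thead tnth_mktuple.
Qed.

Lemma recursive_succ k (f : k.-tuple nat -> nat) :
  recursive f -> recursive (fun v => (f v).+1).
Proof.
move=> rf; apply: recursive_ext (rec_comp rec_succ (fun i : 'I_1 => rf)) _ => v.
by rewrite /thead tnth_mktuple.
Qed.

Lemma recursive_add k (f g : k.-tuple nat -> nat) :
  recursive f -> recursive g -> recursive (fun v => f v + g v)%N.
Proof.
move=> rf rg.
have radd : recursive (fun v : 2.-tuple nat => thead v + thead [tuple of behead v])%N.
  have := @rec_prim 1 _ _ (rec_proj ord0)
    (recursive_succ (rec_proj (Ordinal (isT : 1 < 3)%N))).
  move/recursive_ext; apply=> v.
  have -> : tnth [tuple of behead v] ord0 = thead [tuple of behead v] by [].
  elim: (thead v) => //= j ->; by rewrite addSn.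
pose h (i : 'I_2) := if i == ord0 then f else g.
have rh i : recursive (h i) by rewrite /h; case: ifP.
apply: recursive_ext (rec_comp radd rh) _ => v.
rewrite {1}/thead tnth_mktuple /thead (tnth_nth 0%N) /= nth_behead.
rewrite (nth_map ord0) ?size_enum_ord//.
by rewrite (nth_ord_enum ord0 (Ordinal (isT : 1 < 2)%N)).
Qed.

Lemma recursive_pow2 : recursive (fun v : 2.-tuple nat => (2 ^ (thead v + 4)).-1).
Proof.
(* Start from [15 = 2^4 - 1] and iterate [y -> y + y + 1], which sends [2^a - 1] to [2^(a+1) - 1].
   The predecessor matches the denominators [(r v).+1] of [computable_seq]. *)
have := @rec_prim 1 _ _ (recursive_const 1 15)
    (recursive_succ (recursive_add (rec_proj (Ordinal (isT : 1 < 3)%N))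
      (rec_proj (Ordinal (isT : 1 < 3)%N)))).
move/recursive_ext; apply=> v; elim: (thead v) => //= j ->.
rewrite addSn expnS.
have : (0 < 2 ^ (j + 4))%N by rewrite expn_gt0.
by case: (2 ^ _)%N => // a _; rewrite /= (tnth_nth 0%N) /=; lia.
Qed.

Lemma computable_pow2 (R : realType) :
  computable_seq (fun n : nat => (2 ^ (n + 4))%:R^-1 : R).
Proof.
exists (fun=> 1%N), (fun=> 0%N), (fun v => (2 ^ (thead v + 4)).-1).
split; [exact: recursive_const | exact: recursive_const | exact: recursive_pow2 |].
move=> n k /=.
rewrite theadE prednK ?expn_gt0// subr0 mul1r subrr normr0.
by rewrite invr_ge0 exprn_ge0.
Qed.

(** * Resonant sets and the theorem *)

Lemma measure_bigsetU_le (d : measure_display) (T : measurableType d) (R : realType)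
    (P : {measure set T -> \bar R}) (I : Type) (r : seq I) (Q : pred I)
    (F : I -> set T) :
  (forall i, Q i -> measurable (F i)) ->
  (P (\big[setU/set0]_(i <- r | Q i) F i) <= \sum_(i <- r | Q i) P (F i))%E.
Proof.
move=> mF; elim: r => [|i r IH]; first by rewrite !big_nil measure0.
rewrite !big_cons; case: ifP => // Qi.
apply: (le_trans (measureU2 _ _ _)); [exact: mF|exact: bigsetU_measurable|].
exact: leeD2l.
Qed.

(** [B] is the union of the slabs with coefficients [D b] over nonzero vectors [b] with entries in
    [[-s, s)]: at most [(2 s)^m] of them, each of probability at most [6 eta]. *)
Lemma nonresonant_set (d : measure_display) (T : measurableType d) (R : realType)
    (P : probability T R) (z : nat -> T -> R) (m D s : nat) (eta : R) :
  (forall i, measurable_fun setT (z i)) ->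
  (forall (g : nat -> int), (exists2 i, (i < m)%N & g i != 0) ->
     forall theta eta, 0 < eta ->
     (P [set t | exists a : int,
        (`|\sum_(i < m) (g i)%:~R * z i t + theta + a%:~R| < eta)%R]
        <= (6 * eta)%:E)%E) ->
  (0 < D)%N -> 0 < eta ->
  exists B : set T, [/\ measurable B, (P B <= ((2 * s%:R) ^+ m * (6 * eta))%:E)%E &
    forall t, ~ B t -> forall b : 'I_m -> int, (forall i, (`|b i| < s)%N) ->
      (exists i, b i != 0) -> forall a : int,
      eta <= `|D%:R * (\sum_(i < m) (b i)%:~R * z i t) + a%:~R|].
Proof.
move=> mz slab D0 eta0.
pose bf (f : {ffun 'I_m -> 'I_(2 * s)}) (i : 'I_m) : int := (f i)%:Z - s%:Z.
pose g (f : {ffun 'I_m -> 'I_(2 * s)}) (i : nat) : int :=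
  if insub i is Some j then D%:Z * bf f j else 0.
have gE f (i : 'I_m) : g f i = D%:Z * bf f i by rewrite /g valK.
pose F f := [set t | exists a : int,
  `|\sum_(i < m) (g f i)%:~R * z i t + 0 + a%:~R| < eta].
pose Q f := [exists i, bf f i != 0].
have mF f : measurable (F f).
  apply: (@measurable_slab _ _ _ (fun t => \sum_(i < m) (g f i)%:~R * z i t + 0)).
  apply: measurable_funD => //; apply: measurable_sum => i.
  by apply: measurable_funM.
exists (\big[setU/set0]_(f | Q f) F f); split.
- by apply: bigsetU_measurable => f _.
- apply: (le_trans (measure_bigsetU_le _ _ _)) => //.
  apply: (@le_trans _ _ (\sum_(f | Q f) (6 * eta)%:E)%E).
    apply: lee_sum => f /existsP[i hi]; apply: slab => //.
    exists i => //; rewrite gE mulf_neq0// eqz_nat -lt0n //.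
  rewrite sumEFin lee_fin sumr_const -[X in X <= _]mulr_natl.
  rewrite ler_wpM2r//; first by rewrite mulr_ge0// ltW.
  rewrite -natrM -natrX ler_nat (leq_trans (max_card _))//.
  by rewrite card_ffun !card_ord.
- move=> t nB b hb [i0 bi0] a; rewrite leNgt; apply/negP => h; apply: nB.
  have lt2 i : (absz (b i + s%:Z)%R < 2 * s)%N by have := hb i; clear; lia.
  pose f : {ffun 'I_m -> 'I_(2 * s)} := [ffun i => Ordinal (lt2 i)].
  have bfE i : bf f i = b i.
    by rewrite /bf ffunE /=; have := hb i; clear; lia.
  rewrite (bigD1 f) /=; last by apply/existsP; exists i0; rewrite bfE.
  left; exists a; rewrite addr0.
  suff -> : \sum_(i < m) (g f i)%:~R * z i t = D%:R * \sum_(i < m) (b i)%:~R * z i t.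
    exact: h.
  rewrite mulr_sumr; apply: eq_bigr => i _.
  by rewrite gE bfE rmorphM mulrA.
Qed.

Lemma psi_le_coord (R : realType) (n : nat) (xi : 'rV[R]_n) (j : 'I_n) (a : nat)
    (b0 : int) (t : R) :
  (0 < a)%N -> a%:R <= t -> psi xi t <= `|xi 0 j * a%:R + b0%:~R|.
Proof.
move=> a0 at_.
pose b : 'rV[int]_n := \row_i (if i == j then a%:Z else 0).
have hb : height b = a.
  apply/eqP; rewrite eqn_leq; apply/andP; split.
    by apply/bigmax_leqP => i _; rewrite mxE; case: ifP.
  by apply: leq_trans (leq_bigmax j); rewrite mxE eqxx.
have := @psi_le R n xi t (b, b0); rewrite /= hb => /(_ a0 at_).
rewrite (bigD1 j)//= big1 ?addr0 ?mxE ?eqxx// => i ij.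
by rewrite mxE (negbTE ij) mulr0.
Qed.

Lemma FS_dim (R : realType) (m : nat) (c : R) :
  (0 < m)%N -> 0 < c -> 2 ^+ (m + 6) * c <= 1 ->
  (m%:R%:E <= hausdorff_dim (@euclidean_dist R m.+2) (@FS R m.+2 c))%E.
Proof.
move=> m0 c0 c1.
have c4 : c <= 1 / 4.
  rewrite ler_pdivlMr// mulrC; apply: le_trans c1.
  rewrite ler_pM2r// (_ : 4 = 2 ^+ 2 :> R); last by rewrite expr2; lra.
  by apply: ler_weXn2l; [lra | lia].
have [q [s [p [r [x [y hseq]]]]]] := @denominators_exist R m.+2 c ltac:(by []) c0 c4.
have [d [T [P [z [mz box slab]]]]] := cube_probability R m.
(* The corrections in [norm_form_ge] total at most [(2 c + 11/s) / s^m]: twice [c + 4/s] from the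
   two [L] terms and [3/s] from the [y] term. This is at most [eta k] once [11/s <= 2 c]. *)
pose eta k : R := 4 * c / (s k)%:R ^+ m.
have s0 k : (0 < s k)%N by have [[? ? ?] _ _ _ _] := hseq k; lia.
have s0R k : 0 < (s k)%:R :> R by rewrite ltr0n.
have q0 k : (0 < q k)%N by have [[]] := hseq k.
have eta0 k : 0 < eta k by rewrite divr_gt0 ?exprn_gt0// mulr_gt0.
have /choice[B hB] : forall k, exists B : set T, [/\ measurable B,
    (P B <= ((2 * (s k)%:R) ^+ m * (6 * eta k))%:E)%E &
    forall t, ~ B t -> forall b : 'I_m -> int, (forall i, (`|b i| < s k)%N) ->
      (exists i, b i != 0) -> forall a : int,
      eta k <= `|(q k * s k)%:R * (\sum_(i < m) (b i)%:~R * z i t) + a%:~R|].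
  by move=> k; apply: nonresonant_set => //; rewrite muln_gt0 q0 s0.
have mB k : measurable (B k) by have [] := hB k.
(* The powers of [s k] cancel and leave [24 * 2^m * c], at most [24/64] by the hypothesis on [c]. *)
have PB k : (P (B k) <= (1 / 2)%:E)%E.
  have [_ + _] := hB k; move/le_trans; apply; rewrite lee_fin.
  have -> : (2 * (s k)%:R) ^+ m * (6 * eta k) = 24 / 2 ^+ 6 * (2 ^+ (m + 6) * c).
    by rewrite /eta exprMn exprD; field; rewrite expf_neq0// gt_eqF.
  apply: (@le_trans _ _ (24 / 2 ^+ 6 * 1)); first by rewrite ler_wpM2l// divr_ge0// exprn_ge0.
  by rewrite mulr1 ler_pdivrMr ?exprn_gt0//; lra.
pose E := lim_sup_set (fun k => ~` B k).
have mE : measurable E.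
  apply: bigcapT_measurable => k; apply: bigcup_measurable => j _.
  exact: measurableC.
(* The unions over [j >= k] decrease to [E], and each contains the complement of [B k], of
   probability at least [1/2]; this bound passes to the limit. *)
have PE : (0 < P E)%E.
  apply: (@lt_le_trans _ _ (1 / 2)%:E); first by rewrite lte_fin divr_gt0.
  have mU k : measurable (\bigcup_(j in [set j | (k <= j)%N]) ~` B j).
    by apply: bigcup_measurable => j _; exact: measurableC.
  have hcvg := lim_sup_set_cvg P (fun k => ~` B k) (fun k => measurableC (mB k))
    (le_lt_trans (probability_le1 P (mU 0%N)) (ltry 1)).
  rewrite -(cvg_lim _ hcvg)//; apply: lime_ge; first by apply/cvg_ex; eexists; exact: hcvg.
  apply: nearW => k.
  apply: (@le_trans _ _ (P (~` B k))).
    rewrite probability_setC// leeBrDr; last by rewrite fin_num_measure.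
    apply: (@le_trans _ _ ((1 / 2)%:E + (1 / 2)%:E)%E); first exact: leeD2l.
    by rewrite -EFinD lee_fin; lra.
  by apply: le_measure; rewrite ?inE//; [exact: measurableC | move=> t Bt; exists k => /=].
pose v (t : T) (j : nat) : R :=
  match j with 0%N => x | 1%N => y | i.+2 => z i t end.
pose X (t : T) : 'rV[R]_m.+2 := \row_j v t j.
apply: (@mass_distribution R d T P m.+2 m X (2 ^+ m) E) => //.
(* A Euclidean ball of radius [e] confines each of the last [m] coordinates to an interval of length
   [2 e], whence the constant [2^m]. *)
- move=> u e e0.
  exists [set t | forall i, (i < m)%N -> `|z i t - u 0 (inord i.+2)| <= e]; split.
  + exact: (measurable_box (fun i => u 0 (inord i.+2))).
  + move=> t /= h i im; apply: le_trans h.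
    rewrite -sqrtr_sqr ler_wsqrtr// (bigD1 (inord i.+2))//= mxE inordK//.
    by rewrite lerDl sumr_ge0// => j _; exact: sqr_ge0.
  + by rewrite -exprMn; exact: box.
move=> t Et /=.
have Xx : X t 0 ord0 = x by rewrite mxE.
have Xy : X t 0 (lift ord0 ord0) = y by rewrite mxE.
have Xz i : X t 0 (lift ord0 (lift ord0 i)) = z i t by rewrite mxE.
move: (X t) Xx Xy Xz => xi Xx Xy Xz.
pose L k := (q k)%:R * x - (p k)%:R; pose M k := `|(s k)%:R * y - (r k)%:R|.
apply: (@FS_criterion R m.+2 xi c q s L M) => //.
- lra.
- by move=> k; have [[? ? ?] [? ?] _ _ _] := hseq k.
- by move=> k; have [_ _ _ /ltW ? _] := hseq k; split; rewrite /M.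
- by move=> k; have [_ _ _ _ []] := hseq k.
- by move=> k; have [_ _ _ _ []] := hseq k.
- move=> k u /(psi_le_coord xi ord0 (- (p k)%:Z) (q0 k)).
  rewrite Xx rmorphN /= mulrC ger0_norm//.
  by have [_ _ _ /ltW ? _] := hseq k.
- move=> k u /(psi_le_coord xi (lift ord0 ord0) (- (r k)%:Z) (s0 k)).
  by rewrite Xy rmorphN /= mulrC.
move=> K.
(* Since [k < s k], every [k >= K1] satisfies [11 / s k <= 2 * c]. *)
pose K1 := Num.truncn (11 / (2 * c)).
have [k /= Kk nB] := Et (maxn K K1) I.
exists k; first exact: leq_trans (leq_maxl _ _) Kk.
have [[_ qs ks] [_ qsq] [cpq crs cqs] L0 [hL hM]] := hseq k.
move=> u u1 us; apply: psi_ge => // b b1 bu.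
have bs i : (absz (b.1 ord0 i) < s k)%N.
  rewrite -(ltr_nat R); apply: le_lt_trans us; apply: le_trans bu.
  by rewrite ler_nat; exact: (leq_bigmax (F := fun i => absz (b.1 ord0 i))).
rewrite big_ord_recl big_ord_recl Xx Xy.
set g := (X in x * _ + (y * _ + X)).
have -> : x * (b.1 0 ord0)%:~R + (y * (b.1 0 (lift ord0 ord0))%:~R + g) + b.2%:~R =
  (b.1 0 ord0)%:~R * x + (b.1 0 (lift ord0 ord0))%:~R * y + b.2%:~R + g by ring.
apply: (@norm_form_ge R (q k) (s k) (p k) (r k) x y (L k) (M k) (eta k)) => //.
- have kR : 11 / (2 * c) <= (s k)%:R.
    have /andP[_ /ltW h] := @truncn_itv R (11 / (2 * c))
      ltac:(by rewrite divr_ge0// mulr_ge0// ltW).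
    apply: (le_trans h); rewrite ler_nat.
    by apply: leq_trans ks; rewrite ltnS; apply: leq_trans Kk; exact: leq_maxr.
  have s11 : 11 / (s k)%:R <= 2 * c.
    rewrite ler_pdivrMr// mulrC -ler_pdivrMr//; lra.
  rewrite /eta ler_pdivlMr ?exprn_gt0//.
  have h1 : (s k)%:R ^+ m.+2 * L k <= c + 4 / (s k)%:R.
    by move: hL; rewrite ler_norml => /andP[_ h]; rewrite /L; lra.
  have Lk0 : 0 < L k by [].
  have qsR : (q k)%:R <= (s k)%:R :> R by rewrite ler_nat.
  have h2 : (q k)%:R * (s k)%:R * L k * (s k)%:R ^+ m <= (s k)%:R ^+ m.+2 * L k.
    have -> : (s k)%:R ^+ m.+2 * L k = (s k)%:R * (s k)%:R * L k * (s k)%:R ^+ m.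
      by rewrite !exprS; ring.
    by rewrite ler_pM2r ?exprn_gt0// ler_pM2r// ler_pM2r.
  have h3 : (s k)%:R ^+ 2 * L k * (s k)%:R ^+ m = (s k)%:R ^+ m.+2 * L k.
    by rewrite !exprS expr0; ring.
  have h4 : (q k)%:R * (s k)%:R * M k * (s k)%:R ^+ m <= 3 / (s k)%:R.
    have sq1 : (s k < q k.+1)%N by have [_ []] := hseq k.
    apply: (@le_trans _ _ ((q k.+1)%:R ^+ m.+2 * M k)).
      rewrite mulrAC ler_wpM2r ?normr_ge0//.
      rewrite -natrM -!natrX -natrM ler_nat.
      rewrite (@leq_trans (q k.+1 * q k.+1 ^ m)%N)//.
        rewrite leq_mul// leq_exp2r// ltnW//.
      by rewrite -expnS leq_pexp2l// q0.
    apply: (le_trans hM).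
    by rewrite ler_pM2l// lef_pV2 ?posrE ?ltr0n// ler_nat ltnW.
  have e11 : 11 / (s k)%:R = 8 / (s k)%:R + 3 / (s k)%:R :> R by lra.
  have e8 : 8 / (s k)%:R = 4 / (s k)%:R + 4 / (s k)%:R :> R by lra.
  rewrite !mulrDl; lra.
- rewrite /eta ler_pdivrMr ?exprn_gt0// mul1r.
  apply: (@le_trans _ _ 1); first lra.
  by rewrite exprn_ege1// ler1n.
have gE : g = \sum_(i < m) (b.1 0 (lift ord0 (lift ord0 i)))%:~R * z i t.
  by apply: eq_bigr => i _; rewrite Xz mulrC.
(* If the form involves the random coordinates, [t] outside [B k] gives the bound [eta k]. Otherwise
   [g = 0], and positive height forces one of the first two coefficients to be nonzero. *)
case: (pselect (exists i : 'I_m, b.1 0 (lift ord0 (lift ord0 i)) != 0)) => [hb|hb].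
  right=> a; have [_ _ /(_ t nB)] := hB k.
  move/(_ (fun i => b.1 0 (lift ord0 (lift ord0 i))) (fun i => bs _) hb a).
  by rewrite -gE natrM.
left.
have b0 i : b.1 0 (lift ord0 (lift ord0 i)) = 0.
  by apply/eqP/negPn/negP => hi; apply: hb; exists i.
split; first by rewrite gE big1// => i _; rewrite b0 mul0r.
apply: contraLR b1; rewrite negb_or !negbK => /andP[/eqP h0 /eqP h1].
rewrite -ltnNge ltnS leqn0 -leqn0; apply/bigmax_leqP => i _.
case: (unliftP ord0 i) => [j ->|->]; last by rewrite h0.
by case: (unliftP ord0 j) => [l ->|->]; rewrite ?b0 ?h1.
Qed.

Theorem theorem2p1 (R : realType) :
  exists c_ : nat -> R, computable_seq c_ /\
    forall n : nat, (4 <= n)%N ->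
      0 < c_ n < 1 /\
      forall c : R, 0 < c < c_ n ->
        ((n%:R - 2%:R)%:E <= hausdorff_dim (@euclidean_dist R n) (@FS R n c))%E.
Proof.
(* With [n = m + 2] this is [2^-(m+6)], the threshold in [FS_dim]. *)
exists (fun n : nat => (2 ^ (n + 4))%:R^-1); split; first exact: computable_pow2.
move=> n n4; split.
  rewrite invr_gt0 ltr0n expn_gt0 /= invf_lt1 ?ltr0n ?expn_gt0//.
  by rewrite ltr1n -[1%N]/(2 ^ 0)%N ltn_exp2l// addn_gt0 orbT.
move=> c /andP[c0 cn].
case: n n4 cn => [|[|m]]// n4 cn.
have -> : m.+2%:R - 2%:R = m%:R :> R by rewrite -addn2 natrD addrK.
apply: FS_dim => //; first by lia.
move: cn; rewrite (_ : m.+2 + 4 = m + 6)%N ?addSnnS ?addnA// natrX => /ltW.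
by rewrite -div1r ler_pdivlMr ?exprn_gt0// mulrC.
Qed.
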